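(* Let $r\ge2$. There exists $d_1=d_1(r)$ such that, if $d>d_1$ and $G$ is an $r$-uniform $r$-partite hypergraph with $n$ vertices in each class having property $D(r,n,d)$ (where $1\le d\le n^{r-1}$), then $$\chi_l(G)\le\bigl(g(r,\alpha)+(\log\log d)^{-1/5}\bigr)\log_r d,$$ where $\alpha=\log_n d$.
   Context: Setting: vertex classes $V_1,\dots,V_r$, disjoint, each of size $n$; each edge has one vertex in each class. For $X\subseteq V(G)$, $X_i=X\cap V_i$ and $i_X=\min\{i:|X_i|=\max_j|X_j|\}$. $X$ is $k$-degenerate if every nonempty $Y\subseteq X$ induces $G[Y]$ with a vertex of degree at most $k$. $G$ has property $D(r,n,d)$ if every $X$ with $\prod_{i\ne i_X}|X_i|<n^{r-1}/d$ is $(4\log d/\log\log d)$-degenerate ($\log$ natural). $\chi_l(G)$ is the list chromatic number (least $k$ such that for any lists $|L(v)|\ge k$ one can pick $c(v)\in L(v)$ with no monochromatic edge). The function $g$: For a total order $<$ on $[m]$ and $k\in[m]$, ${\rm rpos}_<(k)=\frac1m|\{j\in[m]:j\le k\text{ in }<\}|$. An $(r,m)$-preference order is $P=(<_1,\dots,<_r)$, total orders on $[m]$; $x\in P$ means $x=({\rm rpos}_{<_1}(k),\dots,{\rm rpos}_{<_r}(k))$ for some $k$. For $x\in[0,1]^r$, $i_x=\min\{i:x_i=\max_jx_j\}$. For $0\le\theta\le1/r$: $f_P(\theta)=\max\{\prod_{i\ne i_x}x_i:x\in P,\ x\in[\theta,1]^r\}$, $f(r,\theta,m)=\min_Pf_P(\theta)$,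 $f(r,\theta)=\inf_mf(r,\theta,m)$. For $0<\alpha\le r-1$, $\beta(\alpha)=\sup\{\theta\in[0,1/r]:\theta^\alpha\le f(r,\theta)\}$ (the solution of $\theta^\alpha=f(r,\theta)$) and $g(r,\alpha)=-1/\log_rf(r,\beta(\alpha))$; $g(r,0)$ is the constant value of $g(r,\alpha)$ on $(0,1]$. *)

(* Defs.v *)
From HB Require Import structures.
From mathcomp Require Import all_boot all_order all_algebra.
From mathcomp Require Import all_classical all_reals all_analysis.

Set Implicit Arguments.
Unset Strict Implicit.
Unset Printing Implicit Defensive.

Import Order.TTheory GRing.Theory Num.Theory.

Local Open Scope ring_scope.

Section FirstMaximum.
Context {R : realType} {r : nat}.
Implicit Types (x : 'I_r -> R) (i : 'I_r).

Definition is_max x i : bool := [forall j, x j <= x i].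

(* i = i_x, the least index at which x attains its maximum *)
Definition is_first_max x i : bool :=
  is_max x i && [forall j : 'I_r, (j < i)%N ==> ~~ is_max x j].

(* \prod_(i != i_x) x_i *)
Definition prod_nonmax x : R := \prod_(i < r | ~~ is_first_max x i) x i.

End FirstMaximum.

Section Hypergraphs.

(* V(G) is the underlying type, the disjoint union of r classes of size n.
   An edge is a set of vertices; it has exactly one vertex in each class, so
   it has r elements. *)
Record partite_hypergraph (r n : nat) := PartiteHypergraph {
  vertex :> finType;
  vclass : 'I_r -> {set vertex};
  edges : {set {set vertex}};
  vclass_disjoint : forall i j, i != j -> [disjoint vclass i & vclass j];
  vclass_cover : forall v, exists i, v \in vclass i;
  card_vclass : forall i, #|vclass i| = n;
  edge_vclass : forall e, e \in edges -> forall i, #|e :&: vclass i| = 1%N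
}.

Context {r n : nat} (G : partite_hypergraph r n).

(* the degree of v in the induced subhypergraph G[Y] *)
Definition induced_degree (Y : {set G}) (v : G) : nat :=
  #|[pred e : {set G} | [&& e \in edges G, e \subset Y & v \in e]]|.

Definition degenerate {R : realType} (k : R) (X : {set G}) : Prop :=
  forall Y : {set G}, Y \subset X -> Y != finset.set0 ->
    exists2 v, v \in Y & (induced_degree Y v)%:R <= k.

Definition property_D {R : realType} (d : R) : Prop :=
  forall X : {set G},
    prod_nonmax (fun i : 'I_r => #|X :&: vclass G i|%:R) < n%:R ^+ r.-1 / d ->
    degenerate (4 * ln d / ln (ln d)) X.

Definition monochromatic (C : finType) (c : G -> C) (e : {set G}) : Prop :=
  exists a, forall v, v \in e -> c v = a.

(* The palette C is arbitrary, so finite palettes allow all systems of finite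
   lists. *)
Definition choosable (k : nat) : Prop :=
  forall (C : finType) (L : G -> {set C}),
    (forall v, (k <= #|L v|)%N) ->
    exists c : G -> C, (forall v, c v \in L v) /\
      (forall e, e \in edges G -> ~ monochromatic c e).

Definition is_list_chromatic (k : nat) : Prop :=
  choosable k /\ forall j, choosable j -> (k <= j)%N.

(* By list_chromaticP below, the default value 0 is irrelevant if r >= 2. *)
Definition list_chromatic : nat := xget 0%N [set k | is_list_chromatic k]%classic.

Lemma choosable_card : (2 <= r)%N -> choosable #|G|.
Proof.
move=> r2 C L HL.
have [c0 Hc0] : exists c0 : G -> C, forall v, c0 v \in L v.
  apply: (@fin_all_exists G (fun=> C) (fun v a => a \in L v)) => v.
  have /card_gt0P[a aL] : (0 < #|L v|)%N.
    by apply: leq_trans (HL v); apply/card_gt0P; exists v.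
  by exists a.
have [c [cL cI]] : exists c : G -> C, (forall v, c v \in L v) /\
    {in enum G &, injective c}.
  have : (size (enum G) <= #|G|)%N by rewrite -cardE.
  elim: (enum G) => [_|v s IH /= sz]; first by exists c0; split.
  have [c [cL cI]] := IH (ltnW sz).
  have [vs|vs] := boolP (v \in s).
    exists c; split => // x y; rewrite !inE.
    by move=> /orP[/eqP->|xs] /orP[/eqP->|ys]; apply: cI.
  have /card_gt0P[a] : (0 < #|L v :\: [set:: map c s]|)%N.
    rewrite cardsD subn_gt0.
    apply: (@leq_ltn_trans #|[set:: map c s]|).
      by apply/subset_leq_card/subsetIr.
    apply: leq_trans (HL v); apply: leq_ltn_trans sz.
    rewrite -(size_map c) cardsE; exact: card_size.
  rewrite !inE => /andP[aN aL].
  exists (fun x => if x == v then a else c x); split.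
    by move=> x; case: eqP => [->|_].
  move=> x y; rewrite !inE.
  case: (eqVneq x v) => [->|xv]; case: (eqVneq y v) => [->|yv] //= xs ys E.
  - by move/negP: aN; case; rewrite E map_f.
  - by move/negP: aN; case; rewrite -E map_f.
  - exact: cI.
exists c; split=> // e eE [a ma].
have pick_v (i : 'I_r) : exists v, v \in e :&: vclass G i.
  by apply/card_gt0P; rewrite edge_vclass.
have r0 : (0 < r)%N by apply: leq_trans r2.
have [v /[!inE] /andP[ve v0]] := pick_v (Ordinal r0).
have [w /[!inE] /andP[we w1]] := pick_v (Ordinal r2).
have vw : v = w by apply: cI; rewrite ?mem_enum // (ma v) // (ma w).
have := @vclass_disjoint _ _ G (Ordinal r0) (Ordinal r2) isT.
by move/disjointFr => /(_ _ v0); rewrite vw w1.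
Qed.

Lemma list_chromaticP : (2 <= r)%N -> is_list_chromatic list_chromatic.
Proof.
move=> r2; rewrite /list_chromatic.
have ex : exists k, `[< choosable k >] by exists #|G|; apply/asboolP/choosable_card.
case: xgetP => [k -> //|/(_ (ex_minn ex))[]].
case: ex_minnP => k /asboolP kc kmin; split=> // j jc.
by apply: kmin; apply/asboolP.
Qed.

End Hypergraphs.

Section PreferenceOrders.
Context {R : realType}.

Definition total_order (m : nat) (le : rel 'I_m) : Prop :=
  [/\ reflexive le, antisymmetric le, transitive le & total le].

Definition rpos (m : nat) (le : rel 'I_m) (k : 'I_m) : R :=
  #|[pred j | le j k]|%:R / m%:R.

(* Each order <_i is given by its reflexive version. *)
Definition preference_order (r m : nat) (P : 'I_r -> rel 'I_m) : Prop :=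
  forall i, total_order (P i).

Definition pref_point (r m : nat) (P : 'I_r -> rel 'I_m) (k : 'I_m) :
  'I_r -> R := fun i => rpos (P i) k.

(* The products are nonnegative and, for m > 0 and theta <= 1/r, some point of P
   lies in [theta, 1]^r, so the default value 0 of the maximum is harmless. *)
Definition fP (r m : nat) (P : 'I_r -> rel 'I_m) (theta : R) : R :=
  \big[Num.max/0]_(k < m | [forall i, theta <= pref_point P k i <= 1])
    prod_nonmax (pref_point P k).

(* There are finitely many P, so this infimum is a minimum for m > 0. *)
Definition fm (r : nat) (theta : R) (m : nat) : R :=
  inf [set fP P theta | P in [set P | @preference_order r m P]]%classic.

Definition f (r : nat) (theta : R) : R :=
  inf [set fm r theta m | m in [set m | (0 < m)%N]]%classic.

Definition log_base (b x : R) : R := ln x / ln b.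

Definition beta (r : nat) (alpha : R) : R :=
  sup [set theta | 0 <= theta <= r%:R^-1 /\
                   theta `^ alpha <= f r theta]%classic.

Definition gpos (r : nat) (alpha : R) : R :=
  - (log_base r%:R (f r (beta r alpha)))^-1.

(* gpos r is constant on (0, 1], and g r 0 is that constant. *)
Definition g (r : nat) (alpha : R) : R :=
  if alpha == 0 then gpos r 1 else gpos r alpha.

End PreferenceOrders.

(* Main.v *)
(* Choose a preference order [P] with [fP P beta] close to [F = f r beta], cut
   each of its orders into [q] intervals of equal length, and give every colour
   an independent random label from [P].  By Caratheodory's theorem the labels
   may be restricted to at most [r * q] of them without changing the interval
   marginals.  A vertex of class [i] chooses a label [t] that occurs more than
   [4 ln d / ln (ln d)] times in its list and is as late as possible in [<_i];
   then almost all labels in its list are at most [t], which has probability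
   about [x_i ^ l] if [t] has position [x].  By the first moment method some
   labelling makes every class of every set [X_t] of vertices that may choose
   [t] about as small as expected.  Either some [x_i < beta], and then class [i]
   of [X_t] is empty or the product of the [x_j] is at most [F] anyway; or the
   product of the non-maximal [x_j] is at most about [F].  As [F ^ l < 1 / d],
   property D makes [X_t] degenerate, so the vertices that chose [t] can be
   coloured greedily from the colours of label [t].  Different labels use
   different colours, hence do not interact. *)

Require Import Defs.
From HB Require Import structures.
From mathcomp Require Import all_boot all_order all_algebra.
From mathcomp Require Import all_classical all_reals all_analysis.
From mathcomp Require Import lra zify.

Set Implicit Arguments.
Unset Strict Implicit.
Unset Printing Implicit Defensive.

Import Order.TTheory GRing.Theory Num.Theory.

Local Open Scope ring_scope.

(** * Preference orders and the function f *)

(** If the earlier factors lose at most [c * e] with [c >= 1], one more factor raises the loss to at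
    most [e + 2 * (c * e) <= 3 * (c * e)]. *)
Lemma prodrD_le (R : realDomainType) (I : Type) (s : seq I) (p : pred I) (z : I -> R) (e : R) :
  0 <= e <= 1 -> (forall i, 0 <= z i <= 1) ->
  \prod_(i <- s | p i) (z i + e) <= \prod_(i <- s | p i) z i + 3 ^+ size s * e.
Proof.
move=> /andP[e0 e1] z01; elim: s => [|a s IH].
  by rewrite !big_nil expr0 mul1r lerDl.
have /andP[a0 a1] := z01 a.
have p0 : 0 <= \prod_(i <- s | p i) z i.
  by apply: prodr_ge0 => i _; case/andP: (z01 i).
have p1 : \prod_(i <- s | p i) z i <= 1 by apply: prodr_ile1 => i _.
have c1 : 1 <= 3 ^+ size s :> R by rewrite exprn_ege1// ler1n.
rewrite !big_cons /= exprS.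
set c := 3 ^+ size s in IH c1 *.
set Q := \prod_(i <- s | p i) (z i + e) in IH *.
set p' := \prod_(i <- s | p i) z i in IH p0 p1 *.
have ce : e <= c * e by rewrite ler_peMl.
case: ifP => _; last by lra.
have h1 : (z a + e) * Q <= (z a + e) * (p' + c * e).
  by apply: ler_wpM2l => //; lra.
have h2 : e * p' <= e by rewrite ler_piMr.
have h3 : z a * (c * e) <= c * e by rewrite ler_piMl //; lra.
have h4 : e * (c * e) <= c * e by rewrite ler_piMl //; lra.
lra.
Qed.

(** The element of [A] of largest rank bounds [A] from above: if it lies below some [j] of [A],
    maximality makes their initial segments equal. *)
Lemma card_le_rank (m : nat) (le : rel 'I_m) (A : {set 'I_m}) :
  total_order le -> A != finset.set0 ->
  exists2 k, k \in A & (#|A| <= #|[pred j | le j k]|)%N.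
Proof.
move=> [rfl asym tr tot] /set0Pn[k0 k0A].
pose rk k := #|[pred j | le j k]|.
case: (@arg_maxnP _ k0 (mem A) rk k0A) => k kA kmax.
exists k => //; apply: subset_leq_card; apply/fintype.subsetP => j jA; rewrite inE.
have /orP[//|kj] := tot j k.
have sub : [pred z | le z k] \subset [pred z | le z j].
  by apply/fintype.subsetP => z; rewrite !inE => zk; apply: tr zk kj.
have eqc : rk k = rk j.
  by apply/eqP; rewrite eqn_leq (subset_leq_card sub) /=; apply: kmax.
have /(_ j) := elimT (subset_cardP eqc) sub.
by rewrite !inE => ->.
Qed.

Section FirstMaximumTheory.
Context {R : realType} {r : nat}.
Implicit Types (x y : 'I_r -> R) (i j : 'I_r).

Lemma ex_first_max x : (0 < r)%N -> exists i, is_first_max x i.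
Proof.
move=> r0; pose i0 := Ordinal r0.
have [k kmax] : exists k, is_max x k.
  case: (@Order.TotalTheory.arg_maxP _ _ _ i0 xpredT x isT) => k _ kmax.
  by exists k; apply/forallP => j; apply: kmax.
case: (@arg_minnP _ k (is_max x) val kmax) => i imax imin.
exists i; rewrite /is_first_max imax; apply/forallP => j; apply/implyP => ji.
by apply: contraL ji => /imin; rewrite -leqNgt.
Qed.

Lemma is_first_max_uniq x i j : is_first_max x i -> is_first_max x j -> i = j.
Proof.
move=> /andP[mi /forallP hi] /andP[mj /forallP hj].
apply: ord_inj; case: (ltngtP i j) => // [ij|ji].
  by have := hj i; rewrite ij mi.
by have := hi j; rewrite ji mj.
Qed.

Lemma prod_nonmaxE x i : is_first_max x i ->
  prod_nonmax x = \prod_(j < r | j != i) x j.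
Proof.
move=> xi; apply: eq_bigl => j; congr (~~ _).
by apply/idP/eqP => [h|->//]; exact: is_first_max_uniq h xi.
Qed.

Lemma prod_nonmax_ge0 x : (forall i, 0 <= x i) -> 0 <= prod_nonmax x.
Proof. by move=> x0; apply: prodr_ge0. Qed.

(** Omitting a largest factor leaves the smallest product, so it suffices to bound the product with
    any convenient coordinate omitted. *)
Lemma prod_nonmax_le x j : (forall i, 0 <= x i) ->
  prod_nonmax x <= \prod_(i < r | i != j) x i.
Proof.
move=> x0; have [i xi] := ex_first_max x (leq_ltn_trans (leq0n j) (ltn_ord j)).
rewrite (prod_nonmaxE xi); have [->//|ij] := eqVneq i j.
rewrite (bigD1 j) 1?eq_sym //= [leRHS](bigD1 i) //=.
have -> : \prod_(k < r | (k != i) && (k != j)) x k =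
          \prod_(k < r | (k != j) && (k != i)) x k.
  by apply: eq_bigl => k; rewrite andbC.
apply: ler_wpM2r; first exact: prodr_ge0.
by move: xi => /andP[/forallP].
Qed.

End FirstMaximumTheory.

Section PreferenceOrderTheory.
Context {R : realType}.

Lemma rpos_gt0 (m : nat) (le : rel 'I_m) k : reflexive le -> 0 < rpos le k :> R.
Proof.
move=> rfl; apply: divr_gt0; rewrite ltr0n; last exact: leq_ltn_trans (ltn_ord k).
by apply/card_gt0P; exists k; rewrite inE.
Qed.

Lemma rpos_le1 (m : nat) (le : rel 'I_m) k : rpos le k <= 1 :> R.
Proof.
have m0 : (0 < m)%N by exact: leq_ltn_trans (ltn_ord k).
by rewrite ler_pdivrMr ?ltr0n// mul1r ler_nat -[leqRHS]card_ord max_card.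
Qed.

Lemma pref_point01 {r m : nat} {P : 'I_r -> rel 'I_m} k i :
  preference_order P -> 0 <= (pref_point P k i : R) <= 1.
Proof. by move=> /(_ i)[rfl _ _ _]; rewrite ltW ?rpos_gt0// rpos_le1. Qed.

Lemma fP_ge0 (r m : nat) (P : 'I_r -> rel 'I_m) (theta : R) : 0 <= fP P theta.
Proof.
rewrite /fP; elim/big_ind: _ => // [x y x0 y0|k].
  by rewrite le_max x0.
by move=> kP; apply: prod_nonmax_ge0 => i; rewrite divr_ge0.
Qed.

Lemma prod_nonmax_le_fP {r m : nat} {P : 'I_r -> rel 'I_m} (theta : R) k :
  (forall i, theta <= pref_point P k i) ->
  prod_nonmax (pref_point P k) <= fP P theta.
Proof.
move=> h; rewrite /fP; apply: (le_bigmax_cond 0 (prod_nonmax \o _)) => /=.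
by apply/forallP => i; rewrite h rpos_le1.
Qed.

Lemma fm_le_fP {r m : nat} {P : 'I_r -> rel 'I_m} (theta : R) :
  preference_order P -> fm r theta m <= fP P theta.
Proof.
move=> PP; apply: ge_inf; last by exists P.
by exists 0 => _ [Q _ <-]; apply: fP_ge0.
Qed.

(** Ensures that the infimum defining [fm] is taken over a nonempty set. *)
Lemma leq_preference_order (r m : nat) :
  preference_order (fun _ : 'I_r => (fun j k : 'I_m => j <= k)%N).
Proof.
move=> i; split.
- by move=> j; apply: leqnn.
- by move=> j k jk; apply/val_inj/eqP; rewrite eqn_leq.
- by move=> j k l; apply: leq_trans.
- by move=> j k; apply: leq_total.
Qed.

Lemma fm_ge (r m : nat) (theta c : R) :
  (forall P : 'I_r -> rel 'I_m, preference_order P -> c <= fP P theta) ->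
  c <= fm r theta m.
Proof.
move=> h; apply: lb_le_inf; last by move=> _ [P PP <-]; apply: h.
by eexists; eexists; [exact: (@leq_preference_order r m)|].
Qed.

Lemma f_le_fP {r m : nat} {P : 'I_r -> rel 'I_m} (theta : R) :
  (0 < m)%N -> preference_order P -> f r theta <= fP P theta.
Proof.
move=> m0 PP; apply: le_trans (fm_le_fP theta PP); apply: ge_inf; last by exists m.
by exists 0 => _ [k _ <-]; apply: fm_ge => Q _; apply: fP_ge0.
Qed.

Lemma f_ge (r : nat) (theta c : R) :
  (forall m (P : 'I_r -> rel 'I_m), (0 < m)%N -> preference_order P ->
     c <= fP P theta) -> c <= f r theta.
Proof.
move=> h; apply: lb_le_inf; last by move=> _ [m m0 <-]; apply: fm_ge => P; apply: h.
by eexists; exists 1%N.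
Qed.

Lemma fP_near_f (r : nat) (theta e : R) : 0 < e ->
  exists m (P : 'I_r -> rel 'I_m),
    [/\ (0 < m)%N, preference_order P & fP P theta < f r theta + e].
Proof.
move=> e0; apply: contrapT => h.
have : f r theta + e <= f r theta.
  apply: f_ge => m P m0 PP; rewrite leNgt; apply/negP => lt.
  by apply: h; exists m, P.
by rewrite gerDl leNgt e0.
Qed.

(** Union bound: in each order fewer than [m / r] elements have position below [1 / r], so the [r]
    orders together exclude fewer than [m] elements. *)
Lemma ex_rpos_ge (r m : nat) (P : 'I_r -> rel 'I_m) :
  (0 < m)%N -> preference_order P ->
  exists k, forall i, r%:R^-1 <= pref_point P k i :> R.
Proof.
move=> m0 PP.
have [r0|r0] := posnP r.
  by exists (Ordinal m0) => i; have := ltn_ord i; rewrite {2}r0.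
pose A i := [set k : 'I_m | (#|[pred j | P i j k]| * r < m)%N].
(* The last element of [A i] has rank at least [#|A i|]. The strict inequality defining [A i] gives
   [m.-1] here, which leaves an element outside the union. *)
have cA i : (#|A i| * r <= m.-1)%N.
  have [->|/(card_le_rank (PP i))[k]] := eqVneq (A i) finset.set0.
    by rewrite cards0.
  rewrite inE => km kA; rewrite -ltnS prednK //.
  by apply: leq_ltn_trans km; rewrite leq_mul2r kA orbT.
have cU : (#|\bigcup_i A i| < m)%N.
  apply: (@leq_ltn_trans m.-1); last by rewrite prednK.
  rewrite -(leq_pmul2r r0); apply: (@leq_trans (\sum_(i < r) #|A i| * r)).
    rewrite -big_distrl leq_mul2r; apply/orP; right.
    elim/big_rec2: _ => [|i B c _ h]; first by rewrite cards0.
    by apply: leq_trans (leq_card_setU _ _) _; rewrite leq_add2l.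
  rewrite (@leq_trans (\sum_(i < r) m.-1)) ?leq_sum//.
  by rewrite sum_nat_const card_ord mulnC.
have /subsetPn[k _ /bigcupP kA] : ~~ ([set: 'I_m] \subset \bigcup_i A i).
  by apply/negP => /subset_leq_card; rewrite cardsT card_ord leqNgt cU.
exists k => i; rewrite /pref_point /rpos ler_pdivlMr ?ltr0n// [leLHS]mulrC ler_pdivrMr ?ltr0n//.
rewrite -natrM ler_nat mulnC leqNgt; apply/negP => lt.
by apply: kA; exists i => //; rewrite inE mulnC.
Qed.

(** Bounds [f] away from 0 in terms of [r] alone, so that additive errors can be turned into
    relative ones. *)
Lemma f_ge_expr (r : nat) (theta : R) : (0 < r)%N -> theta <= r%:R^-1 ->
  r%:R^-1 ^+ r <= f r theta.
Proof.
move=> r0 hth; apply: f_ge => m P m0 PP.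
have [k kP] := ex_rpos_ge m0 PP.
apply: le_trans (@prod_nonmax_le_fP _ _ _ theta k _); last first.
  by move=> i; apply: le_trans (kP i).
apply: (@le_trans _ _ (\prod_(i < r | ~~ is_first_max (pref_point P k : _ -> R) i) r%:R^-1)).
  rewrite prodr_const; apply: ler_wiXn2l; rewrite ?invr_ge0 ?invf_le1 ?ler1n ?ltr0n//.
  by rewrite -[leqRHS]card_ord max_card.
by apply: ler_prod => i _; rewrite kP invr_ge0 ler0n.
Qed.

(** Take two labels, ordered one way in class 0 and the opposite way in all other classes. Each has
    position [1 / 2] either in class 0 or in all the others, and omitting class 1 or class 0
    respectively keeps such a factor. The bound keeps [- ln f] away from 0. *)
Lemma f_le_half (r : nat) (theta : R) : (1 < r)%N -> 0 <= theta -> f r theta <= 2^-1.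
Proof.
move=> r1 th0; pose o : 'I_r := Ordinal (ltnW r1).
pose P (i : 'I_r) : rel 'I_2 := if i == o then fun j k => (j <= k)%N else fun j k => (k <= j)%N.
have PP : preference_order P.
  move=> i; rewrite /P; case: eqP => _; first exact: (@leq_preference_order r 2).
  have [rfl asym tr tot] := @leq_preference_order r 2 o.
  split=> [j|j k /andP[jk kj]|j k l jk kl|j k]; first exact: leqnn.
  - by apply: asym; rewrite kj.
  - exact: tr kl jk.
  - exact: tot.
apply: le_trans (f_le_fP theta (isT : 0 < 2)%N PP) _.
rewrite /fP; apply: bigmax_le => [|k _]; first by rewrite invr_ge0.
have h01 i : 0 <= (pref_point P k i : R) <= 1 by apply: pref_point01.
have half (i : 'I_r) (j : 'I_2) : (j == ord0) = (i == o) ->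
    pref_point P j i = 2^-1 :> R.
  move=> ji; rewrite /pref_point /rpos -[RHS]mul1r; congr (_ / _).
  have -> : #|[pred x | P i x j]| = 1%N; last by [].
  rewrite -[RHS](card1 j); apply: eq_card => x; rewrite !inE /P.
  by move: ji; case: (i == o); case: x => [[|[|//]] hx]; case: j => [[|[|//]] hj].
have [/eqP k0|k0] := boolP (k == ord0).
  apply: le_trans (@prod_nonmax_le _ _ _ (Ordinal r1) _) _; first by move=> i; case/andP: (h01 i).
  rewrite (bigD1 o) //= half ?k0 ?eqxx// ger_pMr ?invr_gt0//.
  by apply: prodr_ile1 => i _; rewrite -k0.
apply: le_trans (@prod_nonmax_le _ _ _ o _) _; first by move=> i; case/andP: (h01 i).
rewrite (bigD1 (Ordinal r1)) //= half ?(negbTE k0)// ger_pMr ?invr_gt0//.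
by apply: prodr_ile1 => i _.
Qed.

(** * The threshold [beta] *)

Section Beta.
Context {r : nat} {alpha : R} (alpha0 : 0 < alpha).

Let B := [set theta : R | 0 <= theta <= r%:R^-1 /\ theta `^ alpha <= f r theta]%classic.

Let supB : has_sup B.
Proof.
split; last by exists r%:R^-1 => t [/andP[]].
exists 0; split; first by rewrite lexx invr_ge0 ler0n.
by rewrite powR0 ?gt_eqF//; apply: f_ge => *; apply: fP_ge0.
Qed.

Lemma beta_ge0 : 0 <= beta r alpha.
Proof.
have [[t tB] ub] := supB.
by apply: le_trans (ub_le_sup ub tB); case: tB => /andP[].
Qed.

Lemma beta_le : beta r alpha <= r%:R^-1.
Proof. by apply: ge_sup; [case: supB|move=> t [/andP[]]]. Qed.

(* Each [fP P] is left-continuous, because the coordinates of [P] take finitely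
   many values; so the supremum defining [beta] is attained. *)
Lemma beta_powR_le : beta r alpha `^ alpha <= f r (beta r alpha).
Proof.
set b := beta r alpha; apply: f_ge => m P m0 PP; rewrite leNgt; apply/negP => lt.
have b0 : 0 < b.
  rewrite lt_neqAle beta_ge0 andbT; apply/eqP => b0.
  by move: lt; rewrite -b0 powR0 ?gt_eqF// ltNge fP_ge0.
pose c := fP P b `^ alpha^-1.
have c0 : 0 <= c by exact: powR_ge0.
have cE : c `^ alpha = fP P b.
  by rewrite /c -powRrM mulVf ?gt_eqF// powRr1// fP_ge0.
have cb : c < b.
  rewrite ltNge; apply/negP => bc; move: lt; rewrite -cE ltNge.
  by rewrite ge0_ler_powR ?nnegrE ?(ltW alpha0) ?(ltW b0).
(* No coordinate of [P] lies strictly between [e] and [b]. Hence for [t > e] a point of [P] in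
   [[t, 1]^r] already lies in [[b, 1]^r], and [fP P t <= fP P b]. Starting the maximum at [c] also
   forces [t > c]. *)
pose e := \big[Num.max/c]_(p : 'I_m * 'I_r | pref_point P p.1 p.2 < b)
            pref_point P p.1 p.2.
have eb : e < b by exact: bigmax_lt.
have [t tB et] := sup_gt (proj1 supB) eb.
have ct : c < t by apply: le_lt_trans et; apply: bigmax_ge_id.
have [/andP[t0 _] tf] := tB.
have : t `^ alpha <= c `^ alpha; last first.
  by rewrite leNgt gt0_ltr_powR ?nnegrE.
apply: le_trans tf _; apply: le_trans (f_le_fP t m0 PP) _; rewrite cE.
apply: bigmax_le => [|k /forallP kt]; first exact: fP_ge0.
apply: prod_nonmax_le_fP => i; rewrite leNgt; apply/negP => ib.
have /andP[+ _] := kt i; rewrite leNgt => /negP; apply; apply: le_lt_trans et.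
exact: (le_bigmax_cond c (fun p : 'I_m * 'I_r => pref_point P p.1 p.2) (j := (k, i)) ib).
Qed.

End Beta.
End PreferenceOrderTheory.

(** * Rounding a preference order *)

(** While the support has more than [#|J|] elements, the rows of [A] over it are linearly dependent;
    moving the weights along a relation until one of them vanishes shrinks the support. The total
    weight is not among the preserved quantities, so the bound is [#|J|] without an additional 1. *)
Lemma caratheodory (R : realFieldType) (I J : finType) (A : I -> J -> R)
    (w : I -> R) : (forall i, 0 <= w i) ->
  exists w' : I -> R, [/\ forall i, 0 <= w' i,
    forall j, \sum_i w' i * A i j = \sum_i w i * A i j &
    (#|[set i | w' i != 0%R]| <= #|J|)%N].
Proof.
have [k] := ubnP #|[set i | w i != 0%R]|; elim: k w => // k IH w wk w0.
have [small|big] := leqP #|[set i | w i != 0%R]| #|J|; first by exists w.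
set S := [set i | w i != 0%R] in wk big.
(* The relation comes from the left kernel of the rows of [A] over [S], with its sign chosen to make
   some entry positive. *)
have [z [zS zA [i0 zi0]]] : exists z : I -> R, [/\ forall i, w i = 0 -> z i = 0,
    forall j, \sum_i z i * A i j = 0 & exists i, 0 < z i].
  pose M : 'M[R]_(#|S|, #|J|) := \matrix_(a, b) A (enum_val a) (enum_val b).
  have /rowV0Pn[v /sub_kermxP vM vn0] : kermx M != 0.
    by rewrite kermx_eq0 -row_leq_rank -ltnNge (leq_ltn_trans (rank_leq_col M)).
  pose z i := \sum_(a | enum_val a == i) v ord0 a.
  have zv a : z (enum_val a) = v ord0 a.
    rewrite /z (big_pred1 a) // => a'.
    by apply/eqP/eqP => [/enum_val_inj|->].
  have zS i : w i = 0 -> z i = 0.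
    move=> wi; rewrite /z big_pred0 // => a; apply/negP => /eqP ai.
    by have := enum_valP a; rewrite ai inE wi eqxx.
  have zA j : \sum_i z i * A i j = 0.
    have : (v *m M) ord0 (enum_rank j) = 0 by rewrite vM mxE.
    rewrite mxE => vM0; rewrite -[RHS]vM0 [RHS](partition_big (@enum_val _ (mem S)) xpredT) //=.
    apply: eq_bigr => i _; rewrite /z big_distrl /=; apply: eq_bigr => a /eqP ai.
    by rewrite mxE enum_rankK ai.
  have [a va] : exists a, v ord0 a != 0.
    apply/existsP; apply: contraNT vn0; rewrite negb_exists => /forallP h.
    apply/eqP/rowP => a; rewrite mxE; apply/eqP.
    by have := h a; rewrite negbK.
  case: (ltrgt0P (v ord0 a)) => va'; last by rewrite va' eqxx in va.
    by exists z; split => //; exists (enum_val a); rewrite zv.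
  exists (fun i => - z i); split=> [i /zS ->|j|]; first by rewrite oppr0.
    by under eq_bigr do rewrite mulNr; rewrite sumrN zA oppr0.
  by exists (enum_val a); rewrite zv oppr_gt0.
(* The least ratio [w i / z i] over the positive entries of [z] is the longest step that keeps all
   weights nonnegative; it kills the weight of [i1]. *)
case: (@Order.TotalTheory.arg_minP _ _ _ i0 (fun i => 0 < z i)
         (fun i => w i / z i) zi0) => i1 zi1 imin.
pose t := w i1 / z i1.
have t0 : 0 <= t by rewrite divr_ge0 // ltW.
pose w1 i := w i - t * z i.
have w10 i : 0 <= w1 i.
  rewrite subr_ge0; have [zi|zi] := leP (z i) 0.
    by apply: le_trans (w0 i); rewrite mulr_ge0_le0.
  by rewrite -ler_pdivlMr //; apply: imin.
have w1i1 : w1 i1 = 0 by rewrite /w1 /t divfK ?subrr // gt_eqF.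
have [w' [w'0 w'A w'c]] : exists w' : I -> R, [/\ forall i, 0 <= w' i,
    forall j, \sum_i w' i * A i j = \sum_i w1 i * A i j &
    (#|[set i | w' i != 0%R]| <= #|J|)%N].
  rewrite ltnS in wk; apply: IH => //; apply: leq_trans wk.
  apply: proper_card; apply/properP; split.
    apply/fintype.subsetP => i; rewrite !inE; apply: contra_neq => wi.
    by rewrite /w1 wi zS // mulr0 subrr.
  exists i1; rewrite !inE ?w1i1 ?eqxx //.
  by apply: contraTneq zi1 => /zS ->; rewrite ltxx.
exists w'; split=> // j; rewrite w'A /w1.
under eq_bigr do rewrite mulrBl -mulrA.
by rewrite big_split /= sumrN -big_distrr /= zA mulr0 subr0.
Qed.

(** Ranks are shifted to start at 0, so that the last position falls into bucket [q - 1] and not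
    [q]. *)
Definition bucket (m q : nat) (le : rel 'I_m) (k : 'I_m) : nat :=
  ((q * #|[pred j | le j k]|.-1) %/ m)%N.

Lemma bucket_lt (m q : nat) (le : rel 'I_m) (k : 'I_m) :
  (0 < q)%N -> (bucket q le k < q)%N.
Proof.
move=> q0; have m0 : (0 < m)%N by exact: leq_ltn_trans (ltn_ord k).
rewrite /bucket ltn_divLR // ltn_pmul2l //.
have : (#|[pred j | le j k]| <= m)%N by rewrite -[leqRHS]card_ord max_card.
lia.
Qed.

(** The last element in the buckets up to that of [k] exceeds the rank of [k] by less than the
    bucket length [m / q]. *)
Lemma card_bucket_le (m q : nat) (le : rel 'I_m) (k : 'I_m) : total_order le ->
  (#|[pred j | (bucket q le j <= bucket q le k)%N]| * q <=
   #|[pred j | le j k]| * q + m)%N.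
Proof.
move=> tle; have m0 : (0 < m)%N by exact: leq_ltn_trans (ltn_ord k).
have rk0 j : (0 < #|[pred j' | le j' j]|)%N.
  by apply/card_gt0P; exists j; rewrite inE; case: tle.
pose A := [set j | (bucket q le j <= bucket q le k)%N].
have A0 : A != finset.set0 by apply/set0Pn; exists k; rewrite inE.
have [j] := card_le_rank tle A0; rewrite inE cardsE => jk Aj.
have : (q * #|[pred j' | le j' j]|.-1 < (bucket q le k).+1 * m)%N.
  by rewrite -ltn_divLR // ltnS.
have := leq_divM (q * #|[pred j' | le j' k]|.-1) m.
rewrite -/(bucket q le k) => h1 h2.
have := rk0 j; have := rk0 k.
move: Aj h1 h2; set a := #|_|; set b := #|_|; set c := #|_|; set e := bucket _ _ _.
move=> ab h1 h2 c0 b0; apply: (@leq_trans (b * q)); first by rewrite leq_mul2r ab orbT.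
case: c c0 h1 => // c _ /= h1; case: b b0 h2 {ab} => // b _ /= h2.
by rewrite !mulSn; nia.
Qed.

(* Uniform weights would do, but the number of labels actually used must be
   bounded independently of [m]. *)
Lemma bucket_weights (R : realType) (r m q : nat) (P : 'I_r -> rel 'I_m) :
  (0 < r)%N -> (0 < m)%N -> (0 < q)%N -> preference_order P ->
  exists w : 'I_m -> R, [/\ forall k, 0 <= w k, \sum_k w k = 1,
    (#|[set k | w k != 0%R]| <= r * q)%N &
    forall i k, \sum_(j | (bucket q (P i) j <= bucket q (P i) k)%N) w j <=
      pref_point P k i + q%:R^-1].
Proof.
move=> r0 m0 q0 PP.
(* The incidence matrix of labels against pairs of a class and a bucket has [r * q] columns. Its
   column sums determine the weight of every union of buckets, in particular the total weight and
   that of every initial segment. *)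
pose A (k : 'I_m) (ib : 'I_r * 'I_q) : R := (bucket q (P ib.1) k == ib.2)%:R.
have [w [w0 wA wc]] := @caratheodory R _ _ A (fun=> m%:R^-1) (fun=> ltac:(by rewrite invr_ge0)).
have split_sum (u : 'I_m -> R) i (p : pred nat) :
    \sum_(k | p (bucket q (P i) k)) u k =
    \sum_(c < q | p c) \sum_k u k * A k (i, c).
  rewrite exchange_big /= big_mkcond /=; apply: eq_bigr => k _.
  pose c0 := Ordinal (bucket_lt (P i) k q0).
  case: ifP => pk.
    rewrite (bigD1 c0) //= /A /= eqxx mulr1 big1 ?addr0 // => c /andP[_ cc0].
    rewrite [_ == _](_ : _ = false) ?mulr0 //; apply/negP => /eqP e.
    by move/eqP: cc0; apply; apply: ord_inj.
  rewrite big1 // => c pc; rewrite /A /= [_ == _](_ : _ = false) ?mulr0 //.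
  by apply/negP => /eqP e; rewrite e pc in pk.
have wE i (p : pred nat) : \sum_(k | p (bucket q (P i) k)) w k =
    #|[pred k | p (bucket q (P i) k)]|%:R / m%:R.
  rewrite split_sum; under eq_bigr do rewrite wA.
  by rewrite -split_sum sumr_const mulr_natl.
exists w; split=> //.
- rewrite (wE (Ordinal r0) xpredT) /= -[X in _ / X%:R](card_ord m) divff //.
  by rewrite pnatr_eq0 card_ord -lt0n.
- by apply: leq_trans wc _; rewrite card_prod !card_ord.
move=> i k; rewrite (wE i (fun c => c <= bucket q (P i) k)%N).
rewrite /pref_point /rpos ler_pdivrMr ?ltr0n // mulrDl divfK ?pnatr_eq0 -?lt0n //.
have q0' : 0 < q%:R :> R by rewrite ltr0n.
rewrite -(ler_pM2r q0') mulrDl mulrAC mulVf ?gt_eqF // mul1r.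
by rewrite -!natrM -natrD ler_nat; apply: card_bucket_le.
Qed.

(** * Colouring degenerate sets from lists *)

Section DegenerateColouring.
Context {r n : nat} {G : partite_hypergraph r n}.

Lemma edge_other (e : {set G}) (v : G) : (2 <= r)%N -> e \in edges G ->
  exists2 u, u \in e & u != v.
Proof.
move=> r2 eE; pose i0 := Ordinal (ltnW r2); pose i1 := Ordinal r2.
have pick_v (i : 'I_r) : exists u, u \in e :&: vclass G i.
  by apply/card_gt0P; rewrite edge_vclass.
have [u /[!inE] /andP[ue u0]] := pick_v i0.
have [u' /[!inE] /andP[ue' u1]] := pick_v i1.
have [uv|] := eqVneq u v; last by exists u.
exists u' => //; apply: contraTneq u1 => ->; rewrite -uv.
by have /disjointFr -> := @vclass_disjoint _ _ G i0 i1 isT.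
Qed.

(** Greedy colouring: remove a vertex of degree at most [kappa], colour the rest by induction, and
    let the vertex avoid one colour for each edge through it. The colouring [c0] serves the empty
    set, as [C] itself might be empty. *)
Lemma degenerate_colouring (R : realType) (kappa : R) (C : finType)
    (c0 : G -> C) (L : G -> {set C}) (X : {set G}) :
  (2 <= r)%N -> degenerate kappa X ->
  (forall v, v \in X -> kappa < #|L v|%:R) ->
  exists c : G -> C, (forall v, v \in X -> c v \in L v) /\
    (forall e, e \in edges G -> e \subset X -> ~ monochromatic c e).
Proof.
move=> r2; have [k] := ubnP #|X|; elim: k X => // k IH X Xk dX LX.
have [X0|X0] := eqVneq X finset.set0.
  exists c0; split=> [v|e eE]; first by rewrite X0 inE.
  rewrite X0 finset.subset0 => /eqP e0; exfalso.
  by have := edge_vclass eE (Ordinal r2); rewrite e0 finset.set0I cards0.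
have [v vX deg] := dX X (subxx X) X0.
have [c [cL cE]] : exists c : G -> C, (forall x, x \in X :\ v -> c x \in L x) /\
    (forall e, e \in edges G -> e \subset X :\ v -> ~ monochromatic c e).
  apply: IH.
  - by move: Xk; rewrite (cardsD1 v X) vX ltnS.
  - by move=> Y YX; apply: dX; apply: fintype.subset_trans YX (subsetDl _ _).
  - by move=> x; rewrite inE => /andP[_]; apply: LX.
(* One other vertex of [e] is enough: if [v] avoids its colour, [e] is not monochromatic. *)
pose u e := odflt v [pick x in e :\ v].
pose E := [pred e : {set G} | [&& e \in edges G, e \subset X & v \in e]].
pose F := [set c (u e) | e in E].
have [a aL aF] : exists2 a, a \in L v & a \notin F.
  apply/subsetPn; apply/negP => /subset_leq_card LF.
  have := LX v vX; rewrite ltNge => /negP; apply; apply: le_trans deg.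
  by rewrite ler_nat; apply: leq_trans LF (leq_imset_card _ _).
exists (fun x => if x == v then a else c x); split=> [x xX|e eE eX [a' mono]].
  case: eqP => [->//|/eqP xv]; apply: cL; by rewrite !inE xv.
have [ve|ve] := boolP (v \in e); last first.
  apply: (cE e eE); first by rewrite subsetD1 eX.
  exists a' => x xe; have := mono x xe; case: eqP => // xv.
  by rewrite -xv xe in ve.
have aa' : a = a' by have := mono v ve; rewrite eqxx.
have [x xe xv] := edge_other v r2 eE.
have ue : u e \in e :\ v.
  by rewrite /u; case: pickP => //= /(_ x); rewrite !inE xv xe.
move: ue; rewrite !inE => /andP[uv ue].
move/negP: aF; apply; apply/imsetP; exists e; first by rewrite !inE eE eX ve.
by have := mono _ ue; rewrite (negbTE uv) aa' => ->.
Qed.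

End DegenerateColouring.

(** * Random labels *)

Section RandomLabels.
Context {R : realType} {C T : finType} (w : T -> R)
  (w0 : forall t, 0 <= w t) (w1 : \sum_t w t = 1).

Definition label_weight (phi : {ffun C -> T}) : R := \prod_c w (phi c).

Lemma label_weight_ge0 phi : 0 <= label_weight phi.
Proof. by apply: prodr_ge0. Qed.

Lemma sum_label_weight : \sum_phi label_weight phi = 1.
Proof. by rewrite /label_weight -(bigA_distr_bigA (fun=> w)) big1. Qed.

(** First moment method. Positivity of the weight of [phi] is recorded because it forces every
    colour to have a label of nonzero weight. *)
Lemma ex_label_lt1 (Y : {ffun C -> T} -> R) :
  \sum_phi label_weight phi * Y phi < 1 ->
  exists2 phi, 0 < label_weight phi & Y phi < 1.
Proof.
move=> EY; apply: contrapT => h; move: EY; rewrite ltNge => /negP; apply.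
rewrite -sum_label_weight; apply: ler_sum => phi _.
have := label_weight_ge0 phi; rewrite le_eqVlt => /predU1P[<-|wp].
  by rewrite mul0r.
rewrite ler_peMr ?(ltW wp) // leNgt; apply/negP => Y1.
by apply: h; exists phi.
Qed.

(* Markov's inequality for [lam ^+ N], where [N] is the number of colours of [A]
   whose label has rank above [m]: the factors of [lam ^+ N] are independent. *)
Lemma few_above_weight (A : {set C}) (b : T -> nat) (m s l : nat) (lam y : R) :
  0 < lam <= 1 -> \sum_(t | (b t <= m)%N) w t + lam <= y -> (l <= #|A|)%N ->
  \sum_phi label_weight phi * (#|[set c in A | (m < b (phi c))%N]| <= s)%N%:R <=
    y ^+ l / lam ^+ s.
Proof.
move=> /andP[l0 l1] wy lA.
pose F (c : C) t := w t * (if (c \in A) && (m < b t)%N then lam else 1).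
(* The expected factor contributed by a single colour of [A]; colours outside [A] contribute 1. *)
pose B := \sum_t w t * (if (m < b t)%N then lam else 1).
have B0 : 0 <= B by apply: sumr_ge0 => t _; rewrite mulr_ge0 //; case: ifP; rewrite ?(ltW l0).
have B1 : B <= 1.
  rewrite -w1; apply: ler_sum => t _; rewrite ler_piMr //; by case: ifP.
have By : B <= y.
  apply: le_trans wy; rewrite /B (bigID (fun t => (b t <= m)%N)) /=.
  apply: lerD.
    by apply: ler_sum => t bt; rewrite ltnNge bt mulr1.
  apply: (@le_trans _ _ (\sum_(t | ~~ (b t <= m)%N) w t * lam)).
    by apply: ler_sum => t bt; rewrite ltnNge bt.
  rewrite -big_distrl /= ler_piMl ?(ltW l0) // -w1.
  by rewrite [leRHS](bigID (fun t => (b t <= m)%N)) /= lerDr sumr_ge0.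
apply: (@le_trans _ _ (\sum_(phi : {ffun C -> T}) (\prod_c F c (phi c)) / lam ^+ s)).
  apply: ler_sum => phi _; rewrite ler_pdivlMr ?exprn_gt0 // /F big_split /=.
  rewrite -/(label_weight phi) -mulrA; apply: ler_wpM2l; first exact: label_weight_ge0.
  rewrite -big_mkcond /= prodr_const.
  have -> : #|[pred c | (c \in A) && (m < b (phi c))%N]| =
            #|[set c in A | (m < b (phi c))%N]| by rewrite cardsE.
  have [Ns|_] := leqP; last by rewrite mul0r exprn_ge0 ?(ltW l0).
  by rewrite mul1r ler_wiXn2l ?(ltW l0).
rewrite -big_distrl /= ler_wpM2r ?invr_ge0 ?exprn_ge0 ?(ltW l0) //.
rewrite -bigA_distr_bigA (bigID (mem A)) /= [X in _ * X]big1 ?mulr1; last first.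
  move=> c cA; rewrite -w1; apply: eq_bigr => t _.
  by rewrite /F (negbTE cA) mulr1.
rewrite (eq_bigr (fun=> B)); last first.
  by move=> c cA; apply: eq_bigr => t _; rewrite /F cA.
rewrite prodr_const; apply: (@le_trans _ _ (B ^+ l)).
  exact: ler_wiXn2l.
by apply: lerXn2r; rewrite // nnegrE // (le_trans B0).
Qed.

End RandomLabels.

(** * From labels of colours to a colouring of the vertices *)

Lemma card_le_sum_fiber (C T : finType) (phi : C -> T) (S : {set T}) (A : {set C}) :
  (forall c, c \in A -> phi c \in S) ->
  (#|A| <= \sum_(t in S) #|[set c in A | phi c == t]|)%N.
Proof.
move=> AS; rewrite -sum1_card (partition_big phi (mem S)) //=.
apply: leq_sum => t _; rewrite sum1_card cardsE.
by apply: subset_leq_card; apply/fintype.subsetP => c.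
Qed.

(* A vertex whose colour list is [L] takes the best label that occurs at least
   [h] times in its list; fewer than [h] colours then have any given better
   label. *)
Lemma ex_frequent_label (C T : finType) (phi : C -> T) (S : {set T})
    (b : T -> nat) (L : {set C}) (h : nat) :
  (forall c, phi c \in S) -> (#|S| * h < #|L|)%N ->
  exists t, [/\ t \in S, (h <= #|[set c in L | phi c == t]|)%N &
    (#|[set c in L | (b t < b (phi c))%N]| <= #|S| * h)%N].
Proof.
move=> phiS hL.
pose Q := [pred t | (t \in S) && (h <= #|[set c in L | phi c == t]|)%N].
have [t0 Qt0] : exists t, Q t.
  apply/existsP; apply: contraLR hL; rewrite negb_exists => /forallP hQ.
  rewrite -leqNgt; apply: leq_trans (card_le_sum_fiber (S := S) (phi := phi) _) _.
    by move=> c _; apply: phiS.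
  rewrite -sum_nat_const; apply: leq_sum => t tS.
  by have := hQ t; rewrite inE tS /= -ltnNge => /ltnW.
case: (@arg_maxnP _ t0 Q b Qt0) => t /andP[tS ht] tmax.
exists t; split=> //.
apply: leq_trans (card_le_sum_fiber (S := S) (phi := phi) _) _.
  by move=> c _; apply: phiS.
rewrite -sum_nat_const; apply: leq_sum => t' t'S.
have [bt|bt] := leqP (b t') (b t).
  rewrite (_ : [set c in _ | _] = finset.set0) ?cards0 //.
  apply/setP => c; rewrite !inE; apply/negP => /andP[/andP[_ lt] /eqP e].
  by move: lt; rewrite e ltnNge bt.
have nQ : ~~ Q t' by apply: contraL bt => /tmax; rewrite -leqNgt.
move: nQ; rewrite inE t'S /= -ltnNge => /ltnW; apply: leq_trans.
apply: subset_leq_card; apply/fintype.subsetP => c; rewrite !inE.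
by move=> /andP[/andP[-> _] ->].
Qed.

(** The probabilistic part, for arbitrary weights and ranks. The factor [K] pays for [lam ^- s] in
    the tail bound, where [s = #|S| * h], and for the union bound over the [r * #|S|] pairs of a
    class and a label. *)
Lemma preference_choosable (R : realType) (r n : nat) (G : partite_hypergraph r n)
    (T : finType) (w : T -> R) (b : 'I_r -> T -> nat) (y : 'I_r -> T -> R)
    (S : {set T}) (kappa lam K : R) (h l : nat) :
  (2 <= r)%N -> (0 < n)%N -> (forall t, 0 <= w t) -> \sum_t w t = 1 ->
  S = [set t | w t != 0] -> 0 < lam <= 1 ->
  (forall i t, \sum_(t' | (b i t' <= b i t)%N) w t' + lam <= y i t) ->
  kappa < h%:R -> (#|S| * h < l)%N ->
  (r * #|S|)%:R < K * lam ^+ (#|S| * h) ->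
  (forall t (X : {set G}), t \in S ->
     (forall i, #|X :&: vclass G i|%:R <= K * n%:R * y i t ^+ l) ->
     degenerate kappa X) ->
  choosable G l.
Proof.
move=> r2 n0 w0 w1 SE lam01 wy kh Shl hK degX C L HL.
have lam0 : 0 < lam by case/andP: lam01.
have n0' : 0 < n%:R :> R by rewrite ltr0n.
have y0 i t : 0 < y i t.
  by apply: lt_le_trans (wy i t); rewrite ltr_wpDl // sumr_ge0.
have K0 : 0 < K.
  have : 0 < K * lam ^+ (#|S| * h) by apply: le_lt_trans hK; rewrite ler0n.
  by rewrite pmulr_lgt0 // exprn_gt0.
set s := (#|S| * h)%N in Shl hK *.
pose N (phi : {ffun C -> T}) i t v := #|[set c in L v | (b i t < b i (phi c))%N]|.
(* This contains all vertices that may choose [t]. Since the classes are disjoint, only the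
   condition for the class of [v] has content. *)
pose X (phi : {ffun C -> T}) t :=
  [set v : G | [forall i, (v \in vclass G i) ==> (N phi i t v <= s)%N]].
pose U i t := K * n%:R * y i t ^+ l.
have U0 i t : 0 < U i t by rewrite !mulr_gt0 // exprn_gt0.
have EX i t : \sum_phi label_weight w phi * #|X phi t :&: vclass G i|%:R <=
    U i t / (K * lam ^+ s).
  apply: (@le_trans _ _ (\sum_phi \sum_(v in vclass G i)
      label_weight w phi * (N phi i t v <= s)%N%:R)).
    apply: ler_sum => phi _; rewrite -big_distrr /=.
    apply: ler_wpM2l; first exact: label_weight_ge0.
    rewrite -natr_sum ler_nat -sum1_card big_mkcond [leqRHS]big_mkcond /=.
    apply: leq_sum => v _; rewrite !inE; case: (boolP (v \in _)) => [vi|]; last by rewrite andbF.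
    rewrite andbT; case: ifP => // /forallP /(_ i); by rewrite vi /= => ->.
  rewrite exchange_big /=.
  apply: (@le_trans _ _ (\sum_(v in vclass G i) y i t ^+ l / lam ^+ s)).
    by apply: ler_sum => v _; apply: few_above_weight.
  rewrite sumr_const card_vclass -mulr_natl /U.
  rewrite [K * n%:R]mulrC -!mulrA ler_pM2l // invfM.
  by rewrite [K * _]mulrCA (mulrA K K^-1) divff ?gt_eqF // mul1r.
(* The summands are nonnegative, so [Y phi < 1] bounds all the ratios by 1 at once. *)
pose Y phi := \sum_(t in S) \sum_i #|X phi t :&: vclass G i|%:R / U i t.
have [phi wphi Yphi] : exists2 phi, 0 < label_weight w phi & Y phi < 1.
  apply: ex_label_lt1 => //.
  apply: (@le_lt_trans _ _ (\sum_(t in S) \sum_(i < r) (K * lam ^+ s)^-1)).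
    rewrite /Y; under eq_bigr do rewrite big_distrr /=.
    rewrite exchange_big /=; apply: ler_sum => t _.
    under eq_bigr do rewrite big_distrr /=.
    rewrite exchange_big /=; apply: ler_sum => i _.
    under eq_bigr do rewrite mulrA.
    rewrite -big_distrl /= ler_pdivrMr // [leRHS]mulrC; exact: EX.
  rewrite !sumr_const card_ord -mulrnA -[_ *+ _]mulr_natl ltr_pdivrMr ?mul1r //.
  by rewrite mulr_gt0 // exprn_gt0.
have Ybound t i : t \in S -> #|X phi t :&: vclass G i|%:R <= U i t.
  move=> tS; rewrite -[leRHS]mul1r -ler_pdivrMr //; apply: le_trans (ltW Yphi).
  have pos t' i' : 0 <= #|X phi t' :&: vclass G i'|%:R / U i' t'.
    by rewrite divr_ge0 // ltW.
  rewrite /Y (bigD1 t) //= (bigD1 i) //= -addrA lerDl addr_ge0 ?sumr_ge0 //.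
  by move=> t' _; apply: sumr_ge0.
have phiS c : phi c \in S.
  rewrite SE inE; apply: contraTneq wphi => e.
  by rewrite /label_weight (bigD1 c) //= e mul0r ltxx.
have label v : exists t, [/\ t \in S, v \in X phi t &
    (h <= #|[set c in L v | phi c == t]|)%N].
  have [i vi] := vclass_cover v.
  have [t [tS ht Nt]] := @ex_frequent_label _ _ phi S (b i) (L v) h phiS (leq_trans Shl (HL v)).
  exists t; split=> //; rewrite inE; apply/forallP => j; apply/implyP => vj.
  have [<-//|ij] := eqVneq i j.
  by have /disjointFr/(_ vi) := @vclass_disjoint _ _ G i j ij; rewrite vj.
have [tv tvP] := choice label.
have [c0 _] : exists c0 : G -> C, forall v, c0 v \in L v.
  apply: (@fin_all_exists G (fun=> C) (fun v c => c \in L v)) => v.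
  have /card_gt0P[c cL] : (0 < #|L v|)%N.
    by apply: leq_trans (HL v); apply: leq_ltn_trans Shl.
  by exists c.
have colouring t : exists ct : G -> C, t \in S ->
    (forall v, tv v = t -> ct v \in [set c in L v | phi c == t]) /\
    (forall e, e \in edges G -> (forall v, v \in e -> tv v = t) ->
       ~ monochromatic ct e).
  have [tS|] := boolP (t \in S); last by exists c0.
  have [//||c [cL cE]] := @degenerate_colouring r n G R kappa C c0
    (fun v => [set c in L v | phi c == t]) [set v | tv v == t] r2.
  - move=> Y' Y't; apply: (degX t (X phi t)) => // [i|].
      exact: Ybound.
    apply: fintype.subset_trans Y't _; apply/fintype.subsetP => v; rewrite inE => /eqP <-.
    by have [] := tvP v.
  - move=> v; rewrite inE => /eqP vt; apply: lt_le_trans kh _.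
    by rewrite ler_nat -vt; have [] := tvP v.
  exists c => _; split=> [v vt|e eE et]; first by apply: cL; rewrite inE vt.
  apply: cE => //; apply/fintype.subsetP => v ve; by rewrite inE et.
have [ct ctP] := choice colouring.
exists (fun v => ct (tv v) v); split=> [v|e eE [a mono]].
  have [tS _ _] := tvP v; have [/(_ v erefl)] := ctP _ tS.
  by rewrite inE => /andP[].
(* A vertex coloured [a] must have chosen the label of [a], so a monochromatic edge would lie inside
   the set of vertices with a single label. *)
have et v : v \in e -> tv v = phi a.
  move=> ve; have [tS _ _] := tvP v; have [/(_ v erefl)] := ctP _ tS.
  by rewrite inE mono // => /andP[_ /eqP].
have [_ /(_ e eE et)] := ctP _ (phiS a); apply.
by exists a => v ve; rewrite -[RHS](mono v ve) et.
Qed.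

(** * The size of the lists *)

Lemma ln_le_sub1 (R : realType) (x : R) : 0 < x -> ln x <= x - 1.
Proof.
move=> x0; have := expR_ge1Dx (ln x); rewrite lnK ?posrE //; lra.
Qed.

(** With the tenth root of [ln (ln d)] as parameter, all powers needed in the size estimate have
    integer exponents. *)
Lemma exp_tower_scale (R : realType) (U d : R) : 1 <= U ->
  expR (expR (U ^+ 10)) < d ->
  exists u : R, [/\ U <= u, ln (ln d) = u ^+ 10, u ^+ 10 <= ln d &
    ln (ln d) `^ (- (1 / 5)) = (u ^+ 2)^-1].
Proof.
move=> U1 dd.
have d0 : 0 < d by apply: lt_trans dd; apply: expR_gt0.
have Ld : expR (U ^+ 10) < ln d by rewrite -ltr_expR lnK ?posrE.
have L0 : 0 < ln d by apply: lt_trans Ld; apply: expR_gt0.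
have Dd : U ^+ 10 < ln (ln d) by rewrite -ltr_expR lnK ?posrE.
have D0 : 0 < ln (ln d) by apply: lt_trans Dd; rewrite exprn_gt0 //; lra.
pose u := ln (ln d) `^ 10%:R^-1.
have uE : ln (ln d) = u ^+ 10.
  by rewrite -powR_mulrn ?powR_ge0 // /u -powRrM mulVf ?powRr1 ?(ltW D0) // pnatr_eq0.
exists u; split=> //.
- rewrite leNgt; apply/negP => uU; move: Dd; rewrite uE ltNge => /negP; apply.
  by apply: lerXn2r; rewrite ?nnegrE ?powR_ge0 // ?(ltW uU) //; lra.
- rewrite -uE; have := expR_ge1Dx (ln (ln d)); rewrite lnK ?posrE //; lra.
- rewrite -powR_mulrn ?powR_ge0 // -powRN /u -powRrM; congr (_ `^ _); lra.
Qed.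

(* With [u = (ln (ln d)) `^ (1 / 10)] and [q] about [u ^+ 3], the rounding loss
   [1 / q] and the loss [q * ln q / ln (ln d)] from the labels both become
   negligible against [u ^- 2 = (ln (ln d)) `^ (- (1 / 5))]. *)
Lemma list_size_estimate (R : realType) (r : nat) (C : R) : (2 <= r)%N -> 0 <= C ->
  exists d1 : R, 1 <= d1 /\ forall d, d1 < d ->
  exists q h : nat, [/\ (1 < q)%N, 4 * ln d / ln (ln d) < h%:R &
    forall (F : R) (l : nat), 0 < F <= 2^-1 ->
      let x := ln d / - ln F + ln (ln d) `^ (- (1 / 5)) * (ln d / ln r%:R) in
      x < l.+1%:R -> l%:R <= x ->
      (r * q * h < l)%N /\
      r%:R * (ln (2 * r%:R ^+ 2 * q%:R) + (r * q * h)%N%:R * ln q%:R) + ln d +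
        l%:R * ln F + l%:R * (C / q%:R) < 0].
Proof.
move=> r2 C0; have [rr rrE] : exists rr : R, r%:R = rr by exists r%:R.
have rr2 : 2 <= rr by rewrite -rrE (ler_nat _ 2).
have rr0' : 0 <= rr by lra.
(* In multiples of [X = L / u ^+ 4], the first two terms are the costs [r1] and [r2'] below; the 1
   absorbs the rounding of [l]. *)
have [B BE] : exists B, B = 4 * rr ^+ 3 + 20 * rr ^+ 2 + 1.
  by exists (4 * rr ^+ 3 + 20 * rr ^+ 2 + 1).
have B1 : 1 <= B.
  by rewrite BE; have := exprn_ge0 3 rr0'; have := exprn_ge0 2 rr0'; lra.
(* For [u >= U], half of the gain [X * u ^+ 2 / rr] covers [(4 * C + B) * u * X]; only half is
   available because [- ln F] is merely known to be at least [1 / 2]. *)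
have [U UE] : exists U, U = 2 * rr * (4 * C + B) + 1.
  by exists (2 * rr * (4 * C + B) + 1).
have U1 : 1 <= U.
  have : 0 <= rr * (4 * C + B) by rewrite mulr_ge0 //; lra.
  rewrite UE; lra.
rewrite rrE; exists (expR (expR (U ^+ 10))); split.
  by have := expR_ge1Dx (expR (U ^+ 10)); have := expR_ge0 (U ^+ 10); lra.
move=> d /(exp_tower_scale U1)[u [Uu DE Lu ->]].
rewrite DE; have [L LE] : exists L, ln d = L by exists (ln d).
rewrite LE in Lu *.
have u1 : 1 <= u by apply: le_trans Uu.
have u0 : 0 < u by lra.
have pu k : 1 <= u ^+ k by rewrite exprn_ege1.
have pu0 k : 0 < u ^+ k by rewrite exprn_gt0.
have [X XE] : exists X, X = L / u ^+ 4 by exists (L / u ^+ 4).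
have LX : L = X * u ^+ 4 by rewrite XE divfK // gt_eqF.
have X6 : u ^+ 6 <= X by rewrite XE ler_pdivlMr // -exprD.
have X1 : 1 <= X by apply: le_trans X6.
have L1 : 1 <= L by apply: le_trans Lu.
pose q := (Num.truncn (u ^+ 3)).+1.
(* The successor makes [h] strictly larger than the degeneracy bound [4 * ln d / ln (ln d)], as the
   greedy colouring requires. *)
pose h := (Num.truncn (4 * L / u ^+ 10)).+1.
have uq : u ^+ 3 < q%:R by apply: truncnS_gt.
have qu : q%:R <= 2 * u ^+ 3.
  have : (Num.truncn (u ^+ 3))%:R <= u ^+ 3 by rewrite truncn_le // ltW.
  by rewrite /q -natr1; have := pu 3%N; lra.
have q0 : 0 < q%:R :> R by rewrite ltr0n.
have hh : 4 * L / u ^+ 10 < h%:R by apply: truncnS_gt.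
have hX : h%:R <= 5 * X / u ^+ 6.
  have E1 : 4 * L / u ^+ 10 = 4 * X / u ^+ 6.
    rewrite LX -[10%N]/(4 + 6)%N exprD invfM.
    suff -> : 4 * (X * u ^+ 4) * (u ^- 4 / u ^+ 6) = 4 * X / u ^+ 6 * (u ^+ 4 / u ^+ 4).
      by rewrite divff ?mulr1 // gt_eqF.
    lra.
  have : (Num.truncn (4 * L / u ^+ 10))%:R <= 4 * L / u ^+ 10.
    by rewrite truncn_le // divr_ge0 ?(ltW (pu0 _)) //; lra.
  have : 1 <= X / u ^+ 6 by rewrite ler_pdivlMr // mul1r.
  have -> : h%:R = (Num.truncn (4 * L / u ^+ 10))%:R + 1 :> R by rewrite natr1.
  rewrite E1 -!mulrA; lra.
have sX : (r * q * h)%N%:R <= 10 * rr * X / u ^+ 3.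
  rewrite !natrM rrE.
  apply: (@le_trans _ _ (rr * (2 * u ^+ 3) * (5 * X / u ^+ 6))).
    by apply: ler_pM => //; rewrite ?mulr_ge0 ?ler0n // ler_wpM2l // ler0n.
  rewrite -[6%N]/(3 + 3)%N exprD invfM.
  suff -> : rr * (2 * u ^+ 3) * (5 * X * (u ^- 3 / u ^+ 3)) =
    10 * rr * X / u ^+ 3 * (u ^+ 3 / u ^+ 3) by rewrite divff ?mulr1 // gt_eqF.
  lra.
have sX1 : (r * q * h)%N%:R <= 10 * rr * X.
  apply: le_trans sX _; rewrite ler_pdivrMr // ler_peMr ?pu // !mulr_ge0 //; lra.
have lq : ln q%:R <= 2 * u ^+ 3.
  by have := ln_le_sub1 q0; lra.
have sq : (r * q * h)%N%:R * ln q%:R <= 20 * rr * X.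
  apply: (@le_trans _ _ (10 * rr * X / u ^+ 3 * (2 * u ^+ 3))).
    by apply: ler_pM => //; rewrite ?ler0n // ln_ge0 // ler1n.
  suff -> : 10 * rr * X / u ^+ 3 * (2 * u ^+ 3) = 20 * rr * X * (u ^+ 3 / u ^+ 3).
    by rewrite divff ?mulr1 // gt_eqF.
  lra.
have rr0 : 0 <= rr ^+ 2 by rewrite exprn_ge0.
have lK : ln (2 * rr ^+ 2 * q%:R) <= 4 * rr ^+ 2 * X.
  have a0 : 0 < 2 * rr ^+ 2 * q%:R by rewrite !mulr_gt0 ?exprn_gt0 //; lra.
  have := ln_le_sub1 a0.
  have : 2 * rr ^+ 2 * q%:R <= 2 * rr ^+ 2 * (2 * X).
    rewrite ler_wpM2l ?mulr_ge0 //; apply: le_trans qu _.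
    rewrite ler_wpM2l //; apply: le_trans X6.
    by rewrite -[6%N]/(3 + 3)%N exprD ler_peMr ?(ltW (pu0 _)).
  lra.
have lr0 : 2^-1 <= ln rr.
  have := @ln_le_sub1 R rr^-1; rewrite lnV ?posrE; last by lra.
  have : rr^-1 <= 2^-1 by rewrite lef_pV2 ?posrE //; lra.
  rewrite invr_gt0; lra.
have lr1 : ln rr <= rr by have := @ln_le_sub1 R rr; lra.
exists q, h; split=> //; first by rewrite -(ltr_nat R); have := pu 3%N; lra.
clear hh hX sX lq DE LE XE.
move=> F l /andP[F0 F1] x xl lx.
have phi0 : 2^-1 <= - ln F by have := ln_le_sub1 F0; lra.
set phi := - ln F in phi0 *.
have xE : x = L / phi + (u ^+ 2)^-1 * (L / ln rr) by [].
pose y := (u ^+ 2)^-1 * (L / ln rr).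
have yX : X * u ^+ 2 / rr <= y.
  suff -> : X * u ^+ 2 / rr = (u ^+ 2)^-1 * (L / rr).
    rewrite /y ler_wpM2l ?invr_ge0 ?(ltW (pu0 _)) // ler_wpM2l ?(le_trans ler01) //.
    by rewrite lef_pV2 // posrE; lra.
  rewrite LX -[4%N]/(2 + 2)%N exprD.
  suff -> : (u ^+ 2)^-1 * (X * (u ^+ 2 * u ^+ 2) / rr) =
    X * u ^+ 2 / rr * (u ^+ 2 / u ^+ 2) by rewrite divff ?mulr1 // gt_eqF.
  lra.
have yL : y <= 2 * L.
  rewrite /y mulrC ler_pdivrMr //; apply: (@le_trans _ _ (2 * L)).
    rewrite ler_pdivrMr; last by lra.
    have : 0 <= L * (2 * ln rr - 1) by rewrite mulr_ge0 //; lra.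
    lra.
  by rewrite ler_peMr ?pu //; lra.
have pL : L / phi <= 2 * L.
  rewrite ler_pdivrMr; last by lra.
  have : 0 <= L * (2 * phi - 1) by rewrite mulr_ge0 //; lra.
  lra.
have uU : 2 * rr * (4 * C + B) * u <= u ^+ 2.
  by rewrite expr2 ler_wpM2r ?(ltW u0) //; move: Uu; rewrite UE; lra.
have uU' : 2 * (4 * C + B) * u <= u ^+ 2 / rr.
  rewrite ler_pdivlMr; last by lra.
  by apply: le_trans uU; lra.
have CB : B <= (4 * C + B) * u.
  apply: (@le_trans _ _ ((4 * C + B) * 1)); first by lra.
  by rewrite ler_wpM2l //; lra.
have XX : X * (2 * (4 * C + B) * u) <= X * (u ^+ 2 / rr).
  by rewrite ler_wpM2l //; lra.
have XB : X * B <= X * ((4 * C + B) * u) by rewrite ler_wpM2l //; lra.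
have XB' : X * B <= X * (B * u) by rewrite ler_wpM2l ?ler_peMr //; lra.
have XBE : X * B = 4 * (X * rr ^+ 3) + 20 * (X * rr ^+ 2) + X by rewrite BE; lra.
have X3 : 0 <= X * rr ^+ 3 by rewrite mulr_ge0 ?exprn_ge0 ?ler0n //; lra.
have X2 : X * rr <= X * rr ^+ 2.
  rewrite ler_wpM2l ?expr2 ?ler_peMr ?ler0n //; lra.
have xl' : L / phi + y < l%:R + 1 by rewrite natr1 -/(x).
have X20 : 0 <= X * rr by rewrite mulr_ge0 //; lra.
have p0 : 0 <= L / phi by rewrite divr_ge0 //; lra.
split.
  rewrite -(ltr_nat R); apply: le_lt_trans sX1 _.
  rewrite -mulrA in yX; lra.
(* Thus [l * phi > L + (y - 1) * phi]: the term [L] cancels [ln d], and [y] has to outweigh all the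
   errors. *)
have lp : (L / phi + y) * phi < (l%:R + 1) * phi by rewrite ltr_pM2r //; lra.
have lC : l%:R * (C / q%:R) <= 4 * C * u * X.
  rewrite mulrA ler_pdivrMr //.
  apply: (@le_trans _ _ (4 * L * C)).
    rewrite ler_wpM2r //; apply: le_trans lx _; rewrite xE; rewrite /y in yL; lra.
  apply: (@le_trans _ _ (4 * C * u * X * u ^+ 3)); last first.
    by rewrite ler_wpM2l ?(ltW uq) // !mulr_ge0 ?(ltW u0) //; lra.
  by rewrite LX (exprS u 3); lra.
have pp : L / phi * phi = L by rewrite divfK // gt_eqF //; lra.
have yp : 2^-1 * (y - 1) <= phi * (y - 1).
  rewrite ler_wpM2r //; rewrite -mulrA in yX; lra.
have r1 : rr * ln (2 * rr ^+ 2 * q%:R) <= rr * (4 * rr ^+ 2 * X) by rewrite ler_wpM2l // ler0n.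
have r2' : rr * ((r * q * h)%N%:R * ln q%:R) <= rr * (20 * rr * X) by rewrite ler_wpM2l // ler0n.
have e3 : rr * (4 * rr ^+ 2 * X) = 4 * (X * rr ^+ 3) by rewrite [rr ^+ 3]exprS; lra.
have e2 : rr * (20 * rr * X) = 20 * (X * rr ^+ 2) by rewrite [rr ^+ 2]expr2; lra.
have -> : ln F = - phi by rewrite opprK.
rewrite -mulrA in yX; lra.
Qed.

(** * The upper bound *)

Lemma prod_nonmax_le_expr (R : realDomainType) (r l : nat) (M : R)
    (z y : 'I_r -> R) (j : 'I_r) :
  0 <= M -> (forall i, 0 <= y i) -> (forall i, 0 <= z i <= M * y i ^+ l) ->
  \prod_(i < r | i != j) z i <= M ^+ r.-1 * (\prod_(i < r | i != j) y i) ^+ l.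
Proof.
move=> M0 y0 zy; apply: (@le_trans _ _ (\prod_(i < r | i != j) (M * y i ^+ l))).
  by apply: ler_prod => i _; apply: zy.
rewrite big_split /= prodr_const prodrXl.
have -> : #|[pred i | i != j]| = r.-1; last by [].
by rewrite -[in RHS](card_ord r) -(cardC1 j); apply: eq_card.
Qed.

(** By [1 + c <= expR c] the error becomes an exponent, and after taking logarithms the claim is the
    last hypothesis. The omitted index [j] need not be a maximum of [z] or [x]. *)
Lemma small_product (R : realType) (r l : nat) (N d k F c e : R)
    (z x : 'I_r -> R) (j : 'I_r) :
  0 < N -> 0 < d -> 0 < F -> 0 <= k -> 0 <= e <= 1 ->
  (forall i, 0 <= x i <= 1) ->
  (forall i, 0 <= z i <= expR k * N * (x i + e) ^+ l) ->
  \prod_(i < r | i != j) x i + 3 ^+ r * e <= F * (1 + c) ->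
  r%:R * k + ln d + l%:R * ln F + l%:R * c < 0 ->
  prod_nonmax z < N ^+ r.-1 / d.
Proof.
move=> N0 d0 F0 k0 e01 x01 zx xF expo.
have /andP[e0 _] := e01.
have xe0 i : 0 <= x i + e by rewrite addr_ge0 //; case/andP: (x01 i).
apply: le_lt_trans (@prod_nonmax_le _ _ _ j _) _; first by move=> i; case/andP: (zx i).
apply: le_lt_trans (prod_nonmax_le_expr j _ xe0 zx) _.
  by rewrite mulr_ge0 ?expR_ge0 ?ltW.
have yF : \prod_(i < r | i != j) (x i + e) <= expR (ln F + c).
  apply: le_trans (prodrD_le (index_enum _) (fun i => i != j) e01 x01) _.
  have -> : size (index_enum 'I_r) = r.
    rewrite -(card_uniqP (index_enum_uniq _)) -[RHS]card_ord; apply: eq_card => i.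
    by rewrite mem_index_enum.
  apply: le_trans xF _.
  by rewrite expRD lnK ?posrE // ler_pM2l // expR_ge1Dx.
have y0 : 0 <= \prod_(i < r | i != j) (x i + e) by apply: prodr_ge0.
apply: (@le_lt_trans _ _ ((expR k * N) ^+ r.-1 * expR (ln F + c) ^+ l)).
  rewrite ler_wpM2l ?exprn_ge0 ?mulr_ge0 ?expR_ge0 ?(ltW N0) //.
  by rewrite lerXn2r // nnegrE ?expR_ge0.
rewrite exprMn mulrAC mulrC ltr_pM2l ?exprn_gt0 //.
have -> : d^-1 = expR (- ln d) by rewrite expRN lnK ?posrE.
rewrite -!expRM_natl -expRD ltr_expR.
have : r.-1%:R * k <= r%:R * k by rewrite ler_wpM2r // ler_nat leq_pred.
lra.
Qed.

(** Here [N = expR (ln d / alpha)] and [beta <= expR (ln F / alpha)], so [alpha] times the logarithm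
    of the bound is at most the expression in the last hypothesis. *)
Lemma small_coordinate (R : realType) (l : nat) (N d k F c e rr alpha beta x : R) :
  0 < N -> alpha * ln N = ln d -> 1 <= alpha <= rr -> 0 < F <= 1 -> 0 <= k ->
  0 <= c -> 0 <= beta -> beta `^ alpha <= F -> 0 <= x <= beta -> 0 <= e <= F * c ->
  rr * k + ln d + l%:R * ln F + l%:R * (rr * c) < 0 ->
  expR k * N * (x + e) ^+ l < 1.
Proof.
move=> N0 Nd /andP[a1 ar] /andP[F0 F1] k0 c0 b0 bF /andP[x0 xb] /andP[e0 ec] expo.
have a0 : 0 < alpha by lra.
have bE : beta <= expR (ln F / alpha).
  have -> : beta = (beta `^ alpha) `^ alpha^-1.
    by rewrite -powRrM divff ?powRr1 // gt_eqF.
  have -> : expR (ln F / alpha) = F `^ alpha^-1.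
    by rewrite /powR gt_eqF // mulrC.
  by rewrite ge0_ler_powR ?nnegrE ?powR_ge0 ?invr_ge0 ?(ltW a0) ?(ltW F0).
have lF0 : ln F <= 0 by rewrite ln_le0.
(* As [alpha >= 1], the additive error [e <= F * c] is also a relative error [c] for
   [expR (ln F / alpha)]. *)
have FE : F <= expR (ln F / alpha).
  rewrite -[leLHS]lnK ?posrE // ler_expR ler_pdivlMr //.
  have : 0 <= - ln F * (alpha - 1) by rewrite mulr_ge0 //; lra.
  lra.
have xe : x + e <= expR (ln F / alpha + c).
  rewrite expRD; apply: (@le_trans _ _ (expR (ln F / alpha) * (1 + c))).
    rewrite mulrDr mulr1; apply: lerD; first exact: le_trans bE.
    by apply: le_trans ec _; rewrite ler_wpM2r.
  by rewrite ler_wpM2l ?expR_ge0 ?expR_ge1Dx.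
have -> : N = expR (ln N) by rewrite lnK ?posrE.
apply: (@le_lt_trans _ _ (expR k * expR (ln N) * expR (ln F / alpha + c) ^+ l)).
  rewrite ler_wpM2l ?mulr_ge0 ?expR_ge0 //.
  by rewrite lerXn2r ?nnegrE ?expR_ge0 // addr_ge0.
rewrite -expRM_natl -!expRD -[ltRHS]expR0 ltr_expR -(pmulr_rlt0 _ a0).
have -> : alpha * (k + ln N + l%:R * (ln F / alpha + c)) =
    alpha * k + alpha * ln N + l%:R * (ln F * (alpha / alpha)) + l%:R * (alpha * c).
  lra.
rewrite divff ?gt_eqF // mulr1 Nd.
have h1 : alpha * k <= rr * k by rewrite ler_wpM2r.
have h2 : l%:R * (alpha * c) <= l%:R * (rr * c) by rewrite ler_wpM2l // ler_wpM2r.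
lra.
Qed.

(** In [(1 + 2 * 3 ^+ r) * e], one [e] is the gap between [fP P] and [F], and the rest is the cost
    of adding [2 * e] to every coordinate in a product. *)
Lemma label_degenerate (R : realType) (r n m l : nat) (G : partite_hypergraph r n)
    (P : 'I_r -> rel 'I_m) (t : 'I_m) (d k c e alpha : R) (X : {set G}) :
  let F := f r (beta r alpha) : R in
  (2 <= r)%N -> (0 < n)%N -> preference_order P -> 1 < d -> property_D G d ->
  0 < alpha <= r%:R -> alpha * ln n%:R = ln d ->
  fP P (beta r alpha) < F + e -> 0 <= k -> 0 < 2 * e <= 1 ->
  (1 + 2 * 3 ^+ r) * e <= F * c ->
  r%:R * k + ln d + l%:R * ln F + l%:R * (r%:R * c) < 0 ->
  (forall i, #|X :&: vclass G i|%:R <=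
     expR k * n%:R * (pref_point P t i + 2 * e) ^+ l) ->
  degenerate (4 * ln d / ln (ln d)) X.
Proof.
move=> F r2 n0 PP d1 PD /andP[a0 ar] nd PF k0 /andP[e0 e1] eF expo hX; apply: PD.
have r0 : (0 < r)%N by apply: ltnW.
have rr1 : 1 <= r%:R :> R by rewrite ler1n.
have b0 := @beta_ge0 R r alpha a0; have br := @beta_le R r alpha a0; have bF := @beta_powR_le R r alpha a0.
have F0 : 0 < F.
  by apply: lt_le_trans (f_ge_expr r0 br); rewrite exprn_gt0 ?invr_gt0 ?ltr0n.
have F2 : F <= 2^-1 by apply: f_le_half.
have N0 : 0 < n%:R :> R by rewrite ltr0n.
have d0 : 0 < d by lra.
have x01 i : 0 <= (pref_point P t i : R) <= 1 by apply: pref_point01.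
have c3 : 0 <= 3 ^+ r :> R by rewrite exprn_ge0.
have c0 : 0 <= c.
  rewrite -(pmulr_rge0 _ F0); apply: le_trans eF; rewrite mulr_ge0 //; lra.
have zx i : 0 <= (#|X :&: vclass G i|%:R : R) <=
     expR k * n%:R * (pref_point P t i + 2 * e) ^+ l by rewrite hX ler0n.
have e01 : 0 <= 2 * e <= 1 by rewrite e1 andbT ltW.
have prodF j : \prod_(i < r | i != j) pref_point P t i <= F + e ->
    prod_nonmax (fun i => #|X :&: vclass G i|%:R) < n%:R ^+ r.-1 / d.
  move=> jF; apply: (@small_product R r l n%:R d k F (r%:R * c) (2 * e) _ _ j
    N0 d0 F0 k0 e01 x01 zx) => //.
  have : F * c <= F * (r%:R * c) by rewrite ler_wpM2l ?ler_peMl // ltW.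
  lra.
have [/forallP xb|] := boolP [forall i, beta r alpha <= pref_point P t i].
  have [j xj] := ex_first_max (pref_point P t : _ -> R) r0.
  apply: (prodF j); rewrite -(prod_nonmaxE xj).
  by apply: le_trans (prod_nonmax_le_fP xb) _; apply: ltW.
rewrite negb_forall => /existsP[i]; rewrite -ltNge => xi.
have /andP[xi0 xi1] := x01 i.
have [j ji] : exists j, i != j.
  have [->|] := eqVneq i (Ordinal r0); last by exists (Ordinal r0).
  by exists (Ordinal r2).
(* If [alpha <= 1] then [x_i < beta <= beta `^ alpha <= F], so the label is good
   whatever its other coordinates; if [alpha > 1] then class [i] is empty. *)
have [a1|a1] := leP alpha 1.
  apply: (prodF j); rewrite (bigD1 i) //=.
  apply: (@le_trans _ _ (pref_point P t i)).
    by rewrite ler_piMr // prodr_ile1 // => i' _.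
  have : beta r alpha <= F.
    apply: le_trans bF; rewrite -[leLHS]powRr1 // ger_powR //.
    rewrite (le_lt_trans xi0 xi) (le_trans br) // invf_le1 //; lra.
  lra.
have Xi : #|X :&: vclass G i| = 0%N.
  apply/eqP; rewrite -leqn0 -ltnS -(ltr_nat R); apply: le_lt_trans (hX i) _.
  apply: (@small_coordinate R l n%:R d k F c (2 * e) r%:R alpha (beta r alpha)) => //.
  - by rewrite ltW.
  - by rewrite F0; lra.
  - by rewrite xi0 ltW.
  - rewrite ltW //=; apply: le_trans eF.
    have : 0 <= 3 ^+ r * e by rewrite mulr_ge0 //; lra.
    have : 1 <= 3 ^+ r :> R by rewrite exprn_ege1 // ler1n.
    by move=> h _; rewrite ler_wpM2r //; lra.
apply: le_lt_trans (@prod_nonmax_le _ _ _ j _) _; first by move=> i'; apply: ler0n.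
by rewrite (bigD1 i) //= Xi mul0r divr_gt0 // exprn_gt0.
Qed.

Theorem theorem3p3 (R : realType) (r : nat) (hr : (2 <= r)%N) :
  exists d1 : R, forall (d : R) (n : nat) (G : partite_hypergraph r n),
    d1 < d -> 1 <= d -> d <= n%:R ^+ r.-1 -> property_D G d ->
    (list_chromatic G)%:R <=
      (g r (log_base n%:R d) + ln (ln d) `^ (- (1 / 5))) * log_base r%:R d.
Proof.
have r0 : (0 < r)%N by apply: ltnW.
have rr0 : 0 < r%:R :> R by rewrite ltr0n.
(* As [F >= r ^- r], this makes the error [(1 + 2 * 3 ^+ r) / q] at most [F * (C0 / q)]. *)
pose C0 : R := (1 + 2 * 3 ^+ r) * r%:R ^+ r.
have C00 : 0 <= C0 by rewrite mulr_ge0 ?exprn_ge0 // addr_ge0 // mulr_ge0 // exprn_ge0.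
have [d1 [d11 size_est]] := @list_size_estimate R r (r%:R * C0) hr (mulr_ge0 (ltW rr0) C00).
exists d1 => d n G dd _ dn PD.
have [q [h [q1 kh hF]]] := size_est d dd.
have d1' : 1 < d by apply: le_lt_trans dd.
have L0 : 0 < ln d by rewrite ln_gt0.
have lr0 : 0 < ln (r%:R : R) by rewrite ln_gt0 // ltr1n.
have N0 : 0 < n%:R :> R.
  rewrite ltr0n lt0n; apply: contraTneq dn => ->.
  by rewrite expr0n -subn1 subn_eq0 leqNgt hr -ltNge; apply: lt_trans d1'.
have n0 : (0 < n)%N by rewrite -(ltr0n R).
have Ln : ln d <= r.-1%:R * ln n%:R.
  rewrite mulr_natl -lnXn // ler_ln ?posrE ?exprn_gt0 //; exact: lt_trans d1'.
have ln0 : 0 < ln (n%:R : R).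
  rewrite ltNge; apply/negP => lnn; have : ln d <= 0; last by rewrite leNgt L0.
  by apply: le_trans Ln _; rewrite mulr_ge0_le0.
pose alpha := log_base n%:R d.
have a0 : 0 < alpha by rewrite divr_gt0.
have anl : alpha * ln n%:R = ln d by rewrite divfK // gt_eqF.
have ar : alpha <= r%:R.
  rewrite ler_pdivrMr //; apply: le_trans Ln _.
  by rewrite ler_wpM2r ?(ltW ln0) // ler_nat leq_pred.
rewrite -/alpha /g (gt_eqF a0) /gpos.
pose F := f r (beta r alpha) : R; rewrite -/F.
have br := @beta_le R r alpha a0.
have Fr : r%:R^-1 ^+ r <= F := f_ge_expr r0 br.
have F0 : 0 < F by apply: lt_le_trans Fr; rewrite exprn_gt0 ?invr_gt0.
have F2 : F <= 2^-1 := f_le_half hr (@beta_ge0 R r alpha a0).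
set eps := _ `^ _ in hF *.
pose x := ln d / - ln F + eps * (ln d / ln r%:R).
have lF0 : 0 < - ln F by have := ln_le_sub1 F0; lra.
have -> : (- (log_base r%:R F)^-1 + eps) * log_base r%:R d = x.
  rewrite /x /log_base mulrDl; congr (_ + _).
  by rewrite invf_div invrN mulrN mulNr mulrC mulrA divfK // gt_eqF.
have x0 : 0 <= x.
  by apply: addr_ge0; [|rewrite mulr_ge0 ?powR_ge0 //]; apply/ltW/divr_gt0.
have /andP[lx xl] := truncn_itv x0.
set l := Num.truncn x in lx xl.
have [lb expo] := hF F l (introT andP (conj F0 F2)) xl lx.
apply: le_trans lx; rewrite ler_nat; apply: (proj2 (list_chromaticP G hr)).
have q0 : 0 < q%:R :> R by rewrite ltr0n ltnW.
have [m [P [m0 PP PF]]] := @fP_near_f R r (beta r alpha) q%:R^-1 (ltac:(by rewrite invr_gt0)).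
have [w [w0 w1 wc wb]] := @bucket_weights R r m q P r0 m0 (ltnW q1) PP.
(* [expR k] must exceed [r * #|S| * lam ^- s] with [#|S| <= r * q], [lam = q^-1] and
   [s <= r * q * h]; the factor 2 makes the inequality strict. *)
pose k : R := ln (2 * r%:R ^+ 2 * q%:R) + (r * q * h)%N%:R * ln q%:R.
have kE : expR k = 2 * r%:R ^+ 2 * q%:R * q%:R ^+ (r * q * h).
  by rewrite expRD expRM_natl !lnK // posrE ?mulr_gt0 // exprn_gt0.
have q1' : 1 <= q%:R :> R by rewrite ler1n ltnW.
have k0 : 0 <= k.
  rewrite addr_ge0 ?mulr_ge0 ?ln_ge0 //.
  rewrite -mulrA mulr_ege1 ?ler1n // mulr_ege1 // exprn_ege1 // ler1n //.
have Sh : (#|[set t | w t != 0%R]| * h <= r * q * h)%N by rewrite leq_mul2r wc orbT.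
apply: (@preference_choosable R r n G 'I_m w (fun i => bucket q (P i))
  (fun i t => pref_point P t i + 2 * q%:R^-1) [set t | w t != 0%R] _ q%:R^-1
  (expR k) h l hr n0 w0 w1 erefl _ _ kh) => //.
- by rewrite invr_gt0 q0 invf_le1.
(* One [q^-1] is the rounding to buckets, the other is [lam]. *)
- move=> i t; apply: (@le_trans _ _ (pref_point P t i + q%:R^-1 + q%:R^-1)).
    by rewrite lerD2r; apply: wb.
  lra.
- exact: leq_ltn_trans lb.
- rewrite kE; apply: (@lt_le_trans _ _ (2 * r%:R ^+ 2 * q%:R)).
    rewrite natrM; apply: (@le_lt_trans _ _ (r%:R * (r%:R * q%:R))).
      by rewrite ler_wpM2l // -natrM ler_nat.
    have : 0 < r%:R ^+ 2 * q%:R :> R by rewrite mulr_gt0 // exprn_gt0.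
    rewrite expr2; lra.
  rewrite -[leLHS]mulr1 -[leRHS]mulrA ler_wpM2l ?mulr_ge0 ?exprn_ge0 //.
  rewrite exprVn ler_pdivlMr ?exprn_gt0 // mul1r.
  by rewrite ler_weXn2l.
move=> t X tS; apply: (@label_degenerate R r n m l G P t d k (C0 / q%:R) q%:R^-1 alpha) => //.
- by rewrite a0.
- rewrite mulr_gt0 ?invr_gt0 //= ler_pdivrMr // mul1r (ler_nat _ 2) //.
- rewrite mulrA ler_wpM2r ?invr_ge0 //.
  rewrite /C0 mulrCA -[leLHS]mulr1 ler_wpM2l //.
  apply: (@le_trans _ _ (r%:R^-1 ^+ r * r%:R ^+ r)).
    by rewrite exprVn mulVf // expf_neq0 // gt_eqF.
  by rewrite ler_wpM2r // exprn_ge0.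
- by rewrite [r%:R * (C0 / _)]mulrA.
Qed.
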